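(* If $L$ is a Latin square of odd order $n$, then $E_{n-1} \equiv 0 \pmod 4$.
   Context: A Latin square of order $n$ is an $n\times n$ matrix with symbols from $[n]=\{1,\dots,n\}$ in which each symbol appears exactly once in each row and exactly once in each column. A diagonal of $L$ is a selection of $n$ entries (cells), exactly one from each row and exactly one from each column. $E_i=E_i(L)$ is the number of diagonals of $L$ on which exactly $i$ distinct symbols appear. *)

(* Defs.v *)
From mathcomp Require Import all_boot all_order all_algebra.

Set Implicit Arguments.
Unset Strict Implicit.
Unset Printing Implicit Defensive.

(* The symbols are taken in 'I_n = {0, ..., n-1} rather than {1, ..., n}, and
   rows and columns are indexed by 'I_n as well. *)
Definition latin_square (n : nat) (L : 'M['I_n]_n) : bool :=
  [forall i : 'I_n, forall s : 'I_n, #|[set j : 'I_n | L i j == s]| == 1]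
  && [forall j : 'I_n, forall s : 'I_n, #|[set i : 'I_n | L i j == s]| == 1].

(* A cell is a pair (row, column). *)
Definition is_diagonal (n : nat) (D : {set 'I_n * 'I_n}) : bool :=
  [forall i : 'I_n, #|[set c in D | c.1 == i]| == 1]
  && [forall j : 'I_n, #|[set c in D | c.2 == j]| == 1].

Definition symbols_on (n : nat) (L : 'M['I_n]_n) (D : {set 'I_n * 'I_n}) :
    {set 'I_n} :=
  [set L c.1 c.2 | c in D].

Definition E (n : nat) (L : 'M['I_n]_n) (i : nat) : nat :=
  #|[set D : {set 'I_n * 'I_n} | is_diagonal D & #|symbols_on L D| == i]|.

(* Main.v *)
Require Import Defs.
From mathcomp Require Import all_boot all_order all_algebra all_fingroup.
From mathcomp Require Import ring zify.
Set Implicit Arguments.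
Unset Strict Implicit.
Unset Printing Implicit Defensive.
Import GRing.Theory.
Local Open Scope ring_scope.

(** For a set S of symbols let A_S be the 0/1 matrix marking the cells whose
    symbol lies in S. Its permanent counts the diagonals whose symbols all lie
    in S, so inclusion-exclusion over S expresses the number of diagonals that
    miss exactly one symbol:

      E_(n-1) = sum over S of (-1)^|S| (n - |S|) per A_S      (n odd),

    see [E_near_transversal_per]. Everything rests on a congruence for integer
    matrices of odd order, [per_mod4]: if all row sums are even and all column
    sums equal an even number k, then, with J the all-ones matrix,

      per A = k per (J - A)  mod 4.

    Applied to A_S with |S| even, where J - A_S = A_(~S), it lets the terms of
    S and of ~S (one of the two sets has even size, as n is odd) cancel: their
    sum is (n - |S|) per A_S - |S| per A_(~S), which is congruent to
    |S| (n - |S| - 1) per A_(~S), and both |S| and n - |S| - 1 are even.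

    Why the congruence holds. Write the last row of A as the constant row k
    minus all the other rows. By linearity in the last row,

      per A = k per A[last := 1] - (sum over i <> last of per A[last := row i]).

    The first permanent is only needed mod 2, where permanents are determinants,
    and row operations over F_2 turn it into per (J - A)
    ([per_ones_row_compl]). A determinant with a repeated row would vanish; the
    permanent with row i repeated is instead congruent mod 4 to
    2 per A[last := e_c], for any fixed unit row e_c ([per_repeated_row]).
    This value does not depend on i, and there are n - 1 such terms, an even
    number, so the whole sum vanishes mod 4. *)

(** * Permanents as multilinear functions of the rows *)

Definition per (n : nat) (A : 'M[int]_n) : int :=
  \sum_(s : 'S_n) \prod_i A i (s i).

Definition setrow (n : nat) (A : 'M[int]_n) (i : 'I_n) (v : 'I_n -> int) :
    'M[int]_n :=
  \matrix_(k, j) if k == i then v j else A k j.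

Definition unit_row (n : nat) (j : 'I_n) : 'I_n -> int := fun l => (l == j)%:R.

Lemma per_setrow n (A : 'M[int]_n) i v :
  per (setrow A i v) =
  \sum_(s : 'S_n) v (s i) * \prod_(k | k != i) A k (s k).
Proof.
apply: eq_bigr => s _; rewrite (bigD1 i) //= mxE eqxx; congr (_ * _).
by apply: eq_bigr => k /negPf ki; rewrite mxE ki.
Qed.

Lemma per_setrow_sum n (A : 'M[int]_n) i (I : finType) c
    (w : I -> 'I_n -> int) v :
    (forall j, v j = \sum_t c t * w t j) ->
  per (setrow A i v) = \sum_t c t * per (setrow A i (w t)).
Proof.
move=> vE; rewrite per_setrow.
under eq_bigr => s _ do rewrite vE mulr_suml.
rewrite exchange_big; apply: eq_bigr => t _ /=.
by rewrite per_setrow mulr_sumr; apply: eq_bigr => s _; rewrite mulrA.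
Qed.

Lemma per_setrowD n (A : 'M[int]_n) i v w :
  per (setrow A i (fun j => v j + w j)) =
  per (setrow A i v) + per (setrow A i w).
Proof.
rewrite !per_setrow -big_split; apply: eq_bigr => s _; exact: mulrDl.
Qed.

Lemma per_setrow_expand n (A : 'M[int]_n) i v :
  per (setrow A i v) = \sum_j v j * per (setrow A i (unit_row j)).
Proof.
apply: per_setrow_sum => j; rewrite (bigD1 j) //= /unit_row eqxx mulr1.
by rewrite big1 ?addr0 // => k /negPf; rewrite eq_sym => ->; rewrite mulr0.
Qed.

Lemma setrow_id n (A : 'M[int]_n) i v : v =1 A i -> setrow A i v = A.
Proof. by move=> vE; apply/matrixP=> k j; rewrite mxE; case: eqP => // ->. Qed.

Lemma setrowC n (A : 'M[int]_n) i k v w : i != k ->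
  setrow (setrow A i v) k w = setrow (setrow A k w) i v.
Proof.
move=> /negPf ik; apply/matrixP=> a b; rewrite !mxE.
by case: (eqVneq a k) => // ->; rewrite eq_sym ik.
Qed.

Lemma per_row_perm n (A : 'M[int]_n) t : per (row_perm t A) = per A.
Proof.
rewrite /per (reindex_inj (mulgI t)); apply: eq_bigr => s _ /=.
rewrite [RHS](reindex_inj (@perm_inj _ t)).
by apply: eq_bigr => i _; rewrite mxE permM.
Qed.

Lemma per_setrow_swap n (A : 'M[int]_n) i k v w : i != k ->
  per (setrow (setrow A i v) k w) = per (setrow (setrow A i w) k v).
Proof.
move=> ik; rewrite -(per_row_perm _ (tperm i k)); congr per.
apply/matrixP=> a b; rewrite !mxE.
have [->|ak] := eqVneq a k; first by rewrite tpermR eqxx (negPf ik).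
have [->|ai] := eqVneq a i; first by rewrite tpermL eqxx.
by rewrite tpermD ?(negPf ak) ?(negPf ai) // eq_sym.
Qed.

Lemma per_unit_row_twice n (A : 'M[int]_n) i k j : i != k ->
  per (setrow (setrow A i (unit_row j)) k (unit_row j)) = 0.
Proof.
move=> ik; apply: big1 => s _; rewrite (bigD1 k) // (bigD1 i) //= !mxE !eqxx.
rewrite (negPf ik) /unit_row; case: (eqVneq (s k) j) => [skj|]; last by rewrite mul0r.
case: (eqVneq (s i) j) => [sij|]; last by rewrite mul0r mulr0.
by case/eqP: ik; apply: (@perm_inj _ s); rewrite skj.
Qed.

(** * Parity of permanents *)

Lemma intF2_eq0 (x : int) : ((x%:~R : 'F_2) == 0) = (2 %| x)%Z.
Proof.
have p2 : 2%N \in [pchar 'F_2] by rewrite inE.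
by rewrite -(dvdz_pcharf p2).
Qed.

Lemma per_F2 n (A : 'M[int]_n) :
  (per A)%:~R = \det (map_mx intr A : 'M['F_2]_n).
Proof.
have N1 : -1 = 1 :> 'F_2 by apply/val_inj.
rewrite rmorph_sum; apply: eq_bigr => s _ /=.
rewrite N1 expr1n mul1r rmorph_prod.
by apply: eq_bigr => i _; rewrite mxE.
Qed.

(** Mod 2 the permanent is the determinant, and the all-ones vector lies in the
    kernel of a matrix over F_2 whose rows sum to zero. *)
Lemma per_even n (A : 'M[int]_n.+1) :
  (forall i, (2 %| \sum_j A i j)%Z) -> (2 %| per A)%Z.
Proof.
move=> Aeven; rewrite -intF2_eq0 per_F2 -det_tr; apply/det0P.
exists (const_mx 1).
  by apply/negP => /eqP/matrixP/(_ 0 0); rewrite !mxE => /eqP; rewrite oner_eq0.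
apply/rowP => i; rewrite !mxE.
have := Aeven i; rewrite -intF2_eq0 rmorph_sum => /eqP Ai0.
by rewrite -[RHS]Ai0; apply: eq_bigr => j _; rewrite !mxE mul1r.
Qed.

(** Let T be the identity with its last row filled with ones. Over F_2, the
    matrix T * (J - A) has the rows 1 + row i, followed by the column sums of
    J - A, which are odd, hence 1. Adding this last row to the others gives
    A[last := 1], and that operation is the transpose of T. As T is triangular
    with unit diagonal, the two determinants agree. *)
Lemma per_ones_row_compl n (A : 'M[int]_n.+1) k :
    odd n.+1 -> (2 %| k)%Z -> (forall j, \sum_i A i j = k) ->
  (2 %| per (setrow A ord_max (fun=> 1)) - per (const_mx 1 - A))%Z.
Proof.
move=> n_odd k_even Acol.
rewrite -intF2_eq0 rmorphB /= subr_eq0 !per_F2; apply/eqP.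
pose T : 'M['F_2]_n.+1 := \matrix_(i, j) ((i == j) || (i == ord_max))%:R.
have detT : \det T = 1.
  rewrite det_trig; first by apply: big1 => i _; rewrite mxE eqxx.
  apply/is_trig_mxP => i j ij; rewrite mxE -!(inj_eq val_inj) /=.
  rewrite ltn_eqF // ltn_eqF //; exact: leq_trans ij (ltn_ord j).
suff TE : T^T *m map_mx intr (setrow A ord_max (fun=> 1)) =
    T *m map_mx intr (const_mx 1 - A).
  by have := congr1 determinant TE; rewrite !det_mulmx det_tr detT !mul1r.
have x2 (x : 'F_2) : x + x = 0 by rewrite -mulr2n -mulr_natl; apply/val_inj.
have xN (x : 'F_2) : - x = x by apply/eqP; rewrite eq_sym -subr_eq0 opprK x2.
apply/matrixP => i j; rewrite !mxE.
have [->|im] := eqVneq i ord_max.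
  rewrite (bigD1 ord_max) //= big1 ?addr0; last first.
    by move=> l /negPf lm; rewrite !mxE lm /= mul0r.
  rewrite !mxE !eqxx mul1r.
  transitivity ((n.+1%:Z - k)%:~R : 'F_2).
    have -> : n.+1%:Z - k = 1 + (n%:Z - k) by lia.
    rewrite rmorphD /=; have /eqP-> : ((n%:Z - k)%:~R : 'F_2) == 0.
      by rewrite intF2_eq0; lia.
    by rewrite addr0.
  rewrite -(Acol j).
  have -> : n.+1%:Z = \sum_(i < n.+1) 1 by rewrite sumr_const card_ord -mulr_natl mulr1 natz.
  rewrite -sumrB rmorph_sum; apply: eq_bigr => l _.
  by rewrite !mxE eqxx orbT mul1r.
rewrite (bigD1 i) // (bigD1 ord_max) /= 1?eq_sym // big1 ?addr0; last first.
  by move=> l /andP[/negPf li /negPf lm]; rewrite !mxE li lm mul0r.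
rewrite [RHS](bigD1 i) //= [X in _ = _ + X]big1 ?addr0; last first.
  by move=> l /negPf li; rewrite !mxE eq_sym li (negPf im) mul0r.
by rewrite !mxE !eqxx (negPf im) orbT /= !mul1r rmorphB /= xN addrC.
Qed.

(** * Permanents modulo 4 *)

Lemma dvdz4_double (x : int) : (2 %| x)%Z -> (4 %| 2 * x)%Z.
Proof. lia. Qed.

Lemma sum_sym n (G : 'I_n -> 'I_n -> int) :
    (forall j k, G j k = G k j) ->
  \sum_j \sum_k G j k = \sum_j G j j + 2 * \sum_(j < n) \sum_(k < n | (j < k)%N) G j k.
Proof.
move=> Gsym.
have -> : \sum_j \sum_k G j k =
    \sum_(j < n) (G j j + (\sum_(k < n | (j < k)%N) G j k + \sum_(k < n | (k < j)%N) G j k)).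
  apply: eq_bigr => j _; rewrite (bigD1 j) //=; congr (_ + _).
  rewrite (bigID (fun k : 'I_n => (j < k)%N)) /=.
  by congr (_ + _); apply: eq_bigl => k; rewrite -(inj_eq val_inj) /=; case: ltngtP.
rewrite !big_split /=; congr (_ + _).
rewrite mulr2n mulrDl mul1r; congr (_ + _).
rewrite (exchange_big_dep predT) //=.
by apply: eq_bigr => j _; apply: eq_bigr => k _.
Qed.

(** Subtracting H j c + H k c from H j k leaves a symmetric form with even
    coefficients, whose off-diagonal terms pair up to multiples of 4 and whose
    diagonal terms are -2 (r j)^2 H j c. Those are 2 (r j) (H j c) mod 4, because
    x^2 = -x mod 2. The subtracted part contributes
    2 (sum of r j) (sum of (r j) (H j c)), a multiple of 4 as r has even sum. *)
Lemma cocycle_form n (H : 'I_n -> 'I_n -> int) (r : 'I_n -> int) c :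
    (forall j k, H j k = H k j) -> (forall j, H j j = 0) ->
    (forall j k, (2 %| H j k - H j c - H k c)%Z) ->
    (2 %| \sum_j r j)%Z ->
  (4 %| \sum_j \sum_k r j * r k * H j k - 2 * \sum_j r j * H j c)%Z.
Proof.
move=> Hsym H0 Hc reven.
pose G j k := r j * r k * (H j k - H j c - H k c).
have -> : \sum_j \sum_k r j * r k * H j k =
    \sum_j \sum_k G j k + 2 * ((\sum_j r j) * \sum_j r j * H j c).
  have e1 : (\sum_j r j) * (\sum_j r j * H j c) =
      \sum_j \sum_k r j * r k * H k c.
    rewrite mulr_suml; apply: eq_bigr => j _; rewrite mulr_sumr.
    by apply: eq_bigr => k _; rewrite mulrA.
  have e2 : (\sum_j r j) * (\sum_j r j * H j c) =
      \sum_j \sum_k r j * r k * H j c.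
    rewrite e1 exchange_big; apply: eq_bigr => j _.
    by apply: eq_bigr => k _; rewrite (mulrC (r j)).
  rewrite mulr2n mulrDl mul1r {1}e1 e2 -!big_split; apply: eq_bigr => j _.
  rewrite -!big_split; apply: eq_bigr => k _; rewrite /G /=; ring.
rewrite sum_sym; last by move=> j k; rewrite /G Hsym; ring.
have -> : forall a b d e : int, a + b + d - e = (a - e) + b + d by move=> *; ring.
apply: rpredD; first apply: rpredD.
- rewrite mulr_sumr -sumrB; apply: rpred_sum => j _; rewrite /G H0.
  have -> : r j * r j * (0 - H j c - H j c) - 2 * (r j * H j c) =
     2 * (r j * (r j + 1)) * - H j c by ring.
  apply/dvdz_mulr/dvdz4_double.
  have [rj|rj] : (2 %| r j)%Z \/ (2 %| r j + 1)%Z by lia.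
    exact: dvdz_mulr.
  exact: dvdz_mull.
- apply: dvdz4_double; apply: rpred_sum => j _; apply: rpred_sum => k _.
  by apply/dvdz_mull/Hc.
- by apply: dvdz4_double; apply/dvdz_mulr.
Qed.

Lemma sum_setrow n (A : 'M[int]_n) i v k :
  \sum_j setrow A i v k j = if k == i then \sum_j v j else \sum_j A k j.
Proof. by case: ifP => ki; apply: eq_bigr => j _; rewrite mxE ki. Qed.

Lemma sum_unit_row n (j : 'I_n) : \sum_l unit_row j l = 1.
Proof.
by rewrite (bigD1 j) //= /unit_row eqxx big1 ?addr0 // => l /negPf ->.
Qed.

(** As a function of rows i and i0 the permanent is a symmetric bilinear form;
    let H j k be its value on the unit rows j and k. It is zero when j = k, since
    a diagonal uses each column once. Putting e_j + e_c and e_k + e_c in the two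
    rows keeps all row sums even, so the permanent is then even, and expanding it
    shows that H satisfies the hypotheses of [cocycle_form]. *)
Lemma per_repeated_row n (A : 'M[int]_n.+1) i i0 c :
    (forall k, (2 %| \sum_j A k j)%Z) -> i != i0 ->
  (4 %| per (setrow A i0 (A i)) - 2 * per (setrow A i0 (unit_row c)))%Z.
Proof.
move=> Aeven ii0.
pose H j k := per (setrow (setrow A i (unit_row j)) i0 (unit_row k)).
have HE k : per (setrow A i0 (unit_row k)) = \sum_j A i j * H j k.
  rewrite -{1}(@setrow_id _ A i (A i)) // setrowC // per_setrow_expand.
  by apply: eq_bigr => j _; rewrite /H setrowC // eq_sym.
rewrite HE per_setrow_expand.
have -> : \sum_k A i k * per (setrow A i0 (unit_row k)) =
    \sum_j \sum_k A i j * A i k * H j k.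
  rewrite exchange_big; apply: eq_bigr => k _; rewrite HE mulr_sumr.
  by apply: eq_bigr => j _; ring.
have Hsym j k : H j k = H k j by rewrite /H per_setrow_swap.
have H0 j : H j j = 0 by apply: per_unit_row_twice.
apply: cocycle_form => // j k.
have : (2 %| per (setrow (setrow A i (fun l => (unit_row j l + unit_row c l)))
    i0 (fun l => unit_row k l + unit_row c l)))%Z.
  apply: per_even => l; rewrite !sum_setrow !big_split !sum_unit_row.
  by case: ifP => // _; case: ifP.
rewrite per_setrowD ![setrow (setrow A _ _) i0 _]setrowC // !per_setrowD.
rewrite ![setrow (setrow A i0 _) _ _]setrowC 1?eq_sym // -!/(H _ _) H0.
rewrite (Hsym c k); lia.
Qed.

(** The last row is the constant row k minus the n other rows. Unlike for a
    determinant, the n permanents with a repeated row that this produces need not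
    vanish, but modulo 4 they all equal the same even number, and n is even. *)
Lemma per_mod4 n (A : 'M[int]_n.+1) k :
    odd n.+1 -> (2 %| k)%Z ->
    (forall i, (2 %| \sum_j A i j)%Z) -> (forall j, \sum_i A i j = k) ->
  (4 %| per A - k * per (const_mx 1 - A))%Z.
Proof.
move=> n_odd k_even Arow Acol.
have perAE : per A = k * per (setrow A ord_max (fun=> 1)) -
    \sum_(i | i != ord_max) per (setrow A ord_max (A i)).
  transitivity (per (setrow A ord_max (fun=> k)) -
      \sum_(i | i != ord_max) per (setrow A ord_max (A i))).
    rewrite (@per_setrow_sum _ A ord_max _ (fun=> 1) (fun i => A i)).
      rewrite (bigD1 ord_max) //= setrow_id // mul1r.
      by under eq_bigr => i _ do rewrite mul1r; rewrite addrK.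
    by move=> j; rewrite -(Acol j); apply: eq_bigr => i _; rewrite mul1r.
  congr (_ - _); rewrite !per_setrow mulr_sumr.
  by apply: eq_bigr => s _; rewrite mulrA mulr1.
have -> : per A - k * per (const_mx 1 - A) =
    k * (per (setrow A ord_max (fun=> 1)) - per (const_mx 1 - A)) -
    \sum_(i | i != ord_max) (per (setrow A ord_max (A i)) -
       2 * per (setrow A ord_max (unit_row ord0))) -
    2 * (n%:Z * per (setrow A ord_max (unit_row ord0))).
  rewrite perAE sumrB sumr_const cardC1 card_ord -mulr_natl natz; ring.
apply: rpredB; first apply: rpredB.
- exact: (dvdz_mul k_even (per_ones_row_compl n_odd k_even Acol)).
- by apply: rpred_sum => i im; apply: per_repeated_row.
- by apply: dvdz4_double; apply: dvdz_mulr; lia.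
Qed.

(** * Inclusion-exclusion over sets of symbols *)

Lemma sum_subsetsD1 (T : finType) (U : {set T}) x (F : {set T} -> int) :
    x \in U ->
  \sum_(V : {set T} | V \subset U) F V =
  \sum_(V : {set T} | V \subset U :\ x) (F V + F (x |: V)).
Proof.
move=> xU; rewrite (bigID (fun V : {set T} => x \in V)) /= addrC big_split /=.
congr (_ + _); first by apply: eq_bigl => V; rewrite subsetD1.
rewrite (reindex_onto (fun V => x |: V) (fun V => V :\ x)) /=; last first.
  by move=> V /andP[_ xV]; rewrite setD1K.
apply: eq_bigl => V; rewrite subsetD1 setU11 andbT subUset sub1set xU /=.
have [xV|xV] := boolP (x \in V); last by rewrite setU1K ?eqxx.
rewrite !andbF; apply/negP => /andP[_ /eqP VE].
by move: xV; rewrite -VE setD11.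
Qed.

Lemma sum_subsets_sign (T : finType) (U : {set T}) :
  \sum_(V : {set T} | V \subset U) (-1) ^+ #|V| = (U == set0)%:R :> int.
Proof.
have [->|[x xU]] := set_0Vmem U.
  rewrite eqxx (big_pred1 set0) ?cards0 //= => V; exact: subset0.
rewrite (sum_subsetsD1 _ xU) big1; last first.
  move=> V; rewrite subsetD1 => /andP[_ xV].
  by rewrite cardsU1 xV exprS mulN1r subrr.
by case: eqP xU => // ->; rewrite inE.
Qed.

(** This is the derivative at -1 of (1 + X)^|U|, up to sign: it detects the sets
    of size one as the alternating sum detects the empty set. *)
Lemma sum_subsets_sign_card (T : finType) (U : {set T}) :
  \sum_(V : {set T} | V \subset U) (-1) ^+ #|V| * #|V|%:Z = - (#|U| == 1%N)%:R.
Proof.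
have [->|[x xU]] := set_0Vmem U.
  by rewrite cards0 oppr0 (big_pred1 set0) ?cards0 ?mulr0 //= => V; exact: subset0.
rewrite (sum_subsetsD1 _ xU).
have -> : (#|U| == 1%N) = (U :\ x == set0).
  by rewrite -cards_eq0 (cardsD1 x U) xU.
rewrite -sum_subsets_sign -sumrN; apply: eq_bigr => V.
rewrite subsetD1 => /andP[_ xV].
by rewrite cardsU1 xV exprS add1n intS; ring.
Qed.

(** Complementing S turns the sum into the weighted alternating sum over the
    subsets of ~: W; the parity of #|T| fixes the sign. *)
Lemma inclusion_exclusion_miss1 (T : finType) (W : {set T}) : odd #|T| ->
  \sum_(S : {set T}) (-1) ^+ #|S| * #|~: S|%:Z * (W \subset S)%:R =
  (#|W| == #|T|.-1)%:R.
Proof.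
move=> T_odd.
transitivity (- \sum_(V : {set T} | V \subset ~: W) (-1) ^+ #|V| * #|V|%:Z).
  rewrite (reindex_inj (@setC_inj T)) [in RHS]big_mkcond -sumrN /=.
  apply: eq_bigr => V _; rewrite setCK -setCS setCK (subsetC V).
  have -> : (-1) ^+ #|~: V| = - (-1) ^+ #|V| :> int.
    rewrite -signr_odd -[in RHS]signr_odd.
    have := cardsC V; move: T_odd => /[swap] <-; rewrite oddD.
    by case: (odd #|V|); case: (odd _).
  by case: ifP; rewrite ?mulr1 ?mulr0 ?oppr0 ?mulNr.
rewrite sum_subsets_sign_card opprK; congr ((nat_of_bool _)%:R).
have := cardsC W; lia.
Qed.

(** * Diagonals of a Latin square and permanents *)

Definition perm_diagonal (n : nat) (s : 'S_n) : {set 'I_n * 'I_n} :=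
  [set (i, s i) | i : 'I_n].

Definition perm_symbols (n : nat) (L : 'M['I_n]_n) (s : 'S_n) : {set 'I_n} :=
  [set L i (s i) | i : 'I_n].

Definition symbol_mx (n : nat) (L : 'M['I_n]_n) (S : {set 'I_n}) : 'M[int]_n :=
  \matrix_(i, j) (L i j \in S)%:R.

Lemma mem_perm_diagonal n (s : 'S_n) c :
  (c \in perm_diagonal s) = (c.2 == s c.1).
Proof.
apply/imsetP/eqP => [[i _ ->] //|cE]; exists c.1 => //.
by rewrite -cE -surjective_pairing.
Qed.

Lemma perm_diagonal_inj n : injective (@perm_diagonal n).
Proof.
move=> s t st; apply/permP => i; apply/eqP.
by rewrite -(mem_perm_diagonal t (i, s i)) -st mem_perm_diagonal /=.
Qed.

Lemma is_diagonalP n (D : {set 'I_n * 'I_n}) :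
  reflect (exists s, D = perm_diagonal s) (is_diagonal D).
Proof.
apply: (iffP andP) => [[/forallP Drow /forallP Dcol]|[s ->]].
  have /fin_all_exists[f fE] i : exists j, [set c in D | c.1 == i] = [set (i, j)].
    have /cards1P[[k j] kjE] := Drow i; exists j; rewrite kjE.
    have : (k, j) \in [set c in D | c.1 == i] by rewrite kjE set11.
    by rewrite inE => /andP[_ /eqP /= ->].
  have fD i : (i, f i) \in D.
    by have : (i, f i) \in [set (i, f i)]; [exact: set11 | rewrite -fE inE => /andP[]].
  have f_inj : injective f.
    move=> i k ik; have /cards1P[c cE] := Dcol (f i).
    have ic : (i, f i) \in [set c] by rewrite -cE inE fD eqxx.
    have kc : (k, f k) \in [set c] by rewrite -cE inE fD /= ik eqxx.
    by move: ic kc; rewrite !inE => /eqP <- /eqP[].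
  exists (perm f_inj); apply/setP => c; rewrite mem_perm_diagonal permE.
  apply/idP/eqP => [cD|cE]; last by rewrite [c]surjective_pairing cE.
  have : c \in [set d in D | d.1 == c.1] by rewrite inE cD eqxx.
  by rewrite fE inE => /eqP ->.
split; apply/forallP => i; apply/cards1P.
  exists (i, s i); apply/setP => -[a b]; rewrite !inE mem_perm_diagonal /= xpair_eqE.
  by rewrite andbC; case: eqP => // ->.
exists ((s^-1)%g i, i); apply/setP => -[a b].
rewrite !inE mem_perm_diagonal /= xpair_eqE.
by case: (eqVneq b i) => [->|]; rewrite ?andbF // !andbT eq_sym (canF_eq (permK s)).
Qed.

Lemma E_perm n (L : 'M['I_n]_n) k :
  E L k = #|[set s : 'S_n | #|perm_symbols L s| == k]|.
Proof.
rewrite /E -(card_imset _ (@perm_diagonal_inj n)); congr #|pred_of_set _|.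
have symE s : symbols_on L (perm_diagonal s) = perm_symbols L s.
  by rewrite /symbols_on /perm_diagonal -imset_comp.
apply/setP => D; rewrite inE; apply/andP/imsetP.
  by case=> /is_diagonalP[s ->] Dk; exists s; rewrite // inE -symE.
case=> s; rewrite inE -symE => sk ->; split=> //.
by apply/is_diagonalP; exists s.
Qed.

Lemma per_symbol_mx n (L : 'M['I_n]_n) S :
  per (symbol_mx L S) = \sum_(s : 'S_n) (perm_symbols L s \subset S)%:R.
Proof.
apply: eq_bigr => s _.
have [sS|] := boolP (_ \subset S).
  apply: big1 => i _; rewrite mxE (subsetP sS) //; exact: imset_f.
case/subsetPn => x /imsetP[i _ ->] /negPf iS.
by rewrite (bigD1 i) //= mxE iS mul0r.
Qed.

Lemma symbol_mxC n (L : 'M['I_n]_n) S :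
  symbol_mx L (~: S) = const_mx 1 - symbol_mx L S.
Proof. by apply/matrixP => i j; rewrite !mxE inE; case: (_ \in S). Qed.

(** Gives the row and column sums of [symbol_mx L S]: a row or a column of a
    Latin square is such an f. *)
Lemma sum_mem_bijective n (f : 'I_n -> 'I_n) (S : {set 'I_n}) :
    (forall s, #|[set j | f j == s]| == 1%N) ->
  \sum_j (f j \in S)%:R = #|S|%:Z.
Proof.
move=> f1.
have -> : \sum_j (f j \in S)%:R = (\sum_j (f j \in S))%N%:Z.
  rewrite -natz natr_sum; exact: eq_bigr.
congr Posz; rewrite -big_mkcond /=.
rewrite (partition_big f (mem S)) //= -[RHS]sum1_card.
apply: eq_bigr => s sS; rewrite -[RHS](eqP (f1 s)) -sum1_card.
by apply: eq_bigl => j; rewrite inE; case: eqP => [->|]; rewrite ?sS ?andbF.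
Qed.

Lemma E_near_transversal_per n (L : 'M['I_n]_n) : odd n ->
  (E L n.-1)%:Z =
  \sum_(S : {set 'I_n}) (-1) ^+ #|S| * #|~: S|%:Z * per (symbol_mx L S).
Proof.
move=> n_odd; rewrite E_perm -sum1_card big_mkcond -natz natr_sum.
under [RHS]eq_bigr => S _ do rewrite per_symbol_mx mulr_sumr.
rewrite exchange_big; apply: eq_bigr => s _ /=.
rewrite inclusion_exclusion_miss1 card_ord // inE; by case: ifP.
Qed.

Lemma latin_per_mod4 n (L : 'M['I_n]_n) (S : {set 'I_n}) :
    odd n -> latin_square L -> ~~ odd #|S| ->
  (4 %| per (symbol_mx L S) - #|S|%:Z * per (symbol_mx L (~: S)))%Z.
Proof.
case: n L S => // n L S n_odd /andP[/forallP Lrow /forallP Lcol] Seven.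
rewrite symbol_mxC; apply: per_mod4 => // [|i|j]; first by lia.
  under eq_bigr => j _ do rewrite mxE.
  by rewrite sum_mem_bijective; [lia | exact/forallP/Lrow].
under eq_bigr => i _ do rewrite mxE.
by rewrite (@sum_mem_bijective _ (fun i => L i j)) //; exact/forallP/Lcol.
Qed.

Lemma dvdz4_near_transversals n (L : 'M['I_n]_n) :
  odd n -> latin_square L -> (4 %| (E L n.-1)%:Z)%Z.
Proof.
move=> n_odd L_latin.
rewrite E_near_transversal_per // (bigID (fun S : {set 'I_n} => ~~ odd #|S|)) /=.
(* The odd sets are the complements of the even ones, as n is odd. *)
rewrite [X in _ + X](reindex_inj (@setC_inj _)) /=.
have oddC (S : {set 'I_n}) : odd #|~: S| = ~~ odd #|S|.
  by have := cardsC S; rewrite card_ord; lia.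
have -> : \sum_(S : {set 'I_n} | ~~ ~~ odd #|~: S|)
    (-1) ^+ #|~: S| * #|~: ~: S|%:Z * per (symbol_mx L (~: S)) =
  \sum_(S : {set 'I_n} | ~~ odd #|S|)
    - (#|S|%:Z * per (symbol_mx L (~: S))).
  apply: eq_big => [S|S]; first by rewrite negbK oddC.
  by rewrite negbK => So; rewrite setCK -signr_odd So mulN1r mulNr.
rewrite -big_split /=; apply: rpred_sum => S Seven.
rewrite -signr_odd (negPf Seven) mul1r.
set f := per (symbol_mx L S); set g := per (symbol_mx L (~: S)).
have -> : #|~: S|%:Z * f - #|S|%:Z * g = #|~: S|%:Z * (f - #|S|%:Z * g)
    + (#|S|%:Z * (#|~: S|%:Z - 1)) * g by ring.
apply: rpredD; first exact/dvdz_mull/latin_per_mod4.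
have Se : (2 %| #|S|%:Z)%Z by lia.
have Ce : (2 %| #|~: S|%:Z - 1)%Z by have := oddC S; lia.
exact: dvdz_mulr (dvdz_mul Se Ce).
Qed.

Local Close Scope ring_scope.

Theorem theorem38 (n : nat) (L : 'M['I_n]_n) :
  odd n -> latin_square L -> E L n.-1 = 0 %[mod 4].
Proof.
by move=> n_odd L_latin; have := dvdz4_near_transversals n_odd L_latin; lia.
Qed.
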